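(* Let $\mathcal{C}$ be an $[n,k]$ code over a prime field $\mathbb{F}_p$ with primitive element $\alpha$, and let $\mathbf{g}_1,\dots,\mathbf{g}_k$ be the row vectors of a generator matrix for $\mathcal{C}$ in standard form. Then the reduced Gröbner basis of the generalized code ideal $I_+(\mathcal{C})\subseteq\mathbb{K}[\mathbf{x}]$ with respect to the lexicographic order with $x_{11}\succ x_{12}\succ\dots\succ x_{n,p-1}$ is \begin{align*} \mathcal{G}=&\left\{x_{ij}-\underline{\mathbf{x}}_{p-1}^{\mathbf{m}_i^{(j)}}\mid 1\le i\le k,\ 1\le j\le p-1\right\}\\ &\cup\left\{x_{ij}-x_{i,p-1}^{\alpha^j}\mid k+1\le i\le n,\ 1\le j\le p-2\right\}\\ &\cup\left\{x_{i,p-1}^p-1\mid k+1\le i\le n\right\}, \end{align*} where $\mathbf{m}_i^{(j)}=(\mathbf{e}_i-\mathbf{g}_i)\alpha^j\in\mathbb{F}_p^n$ for $1\le i\le k$, $1\le j\le p-1$, and $\underline{\mathbf{x}}_{p-1}=(x_{1,p-1},\dots,x_{n,p-1})$.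
   Context: $\mathbb{K}$ is an arbitrary field and $p$ is a prime; $\mathbb{F}_p=\{0,\alpha,\alpha^2,\dots,\alpha^{p-1}=1\}$. An $[n,k]$ code is a $k$-dimensional linear subspace of $\mathbb{F}_p^n$ (row vectors); a generator matrix is a $k\times n$ matrix whose rows form a basis of $\mathcal{C}$; it is in standard form if it equals $(I_k\mid M)$. $\mathbf{e}_i$ denotes the $i$th unit vector. Variables: $\mathbf{x}=(\mathbf{x}_1,\dots,\mathbf{x}_n)$ with $\mathbf{x}_j=(x_{j1},\dots,x_{j,p-1})$; the lexicographic order has variables ordered $x_{11}\succ\dots\succ x_{1,p-1}\succ x_{21}\succ\dots\succ x_{n,p-1}$. Whenever an element of $\mathbb{F}_p$ (or a vector in $\mathbb{F}_p^n$) appears as an exponent, it is read as its integer representative in $\{0,\dots,p-1\}$ (entrywise); thus $\underline{\mathbf{x}}_{p-1}^{m}=x_{1,p-1}^{m_1}\cdots x_{n,p-1}^{m_n}$. Crossing map: $\blacktriangle:\mathbb{F}_p^n\to\mathbb{Z}^{n(p-1)}$ sends $(a_1,\dots,a_n)$ to the concatenation of $n$ blocks of length $p-1$, where the $j$th block is the unit vector $\mathbf{e}_{u}$ if $a_j=\alpha^{u}$ with $1\le u\le p-1$, and the zero vector if $a_j=0$. Thus $\mathbf{x}^{\blacktriangle a}=\prod_{j:\,a_j=\alpha^{u_j}\neq0}x_{j,u_j}$. The ideal $I_q$ (here $q=p$) of $\mathbb{K}[\mathbf{x}]$ is generated, for all $1\le j\le n$ and $1\le u,v,w\le p-1$, by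 the binomials $x_{ju}x_{jv}-x_{jw}$ whenever $\alpha^u+\alpha^v=\alpha^w$, and $x_{ju}x_{jv}-1$ whenever $\alpha^u+\alpha^v=0$ ($u=v$ allowed). Generalized code ideal: $$I_+(\mathcal{C})=\langle\mathbf{x}^{\blacktriangle a}-\mathbf{x}^{\blacktriangle b}\mid a,b\in\mathbb{F}_p^n,\ a-b\in\mathcal{C}\rangle+I_q\subseteq\mathbb{K}[\mathbf{x}].$$ The reduced Gröbner basis of an ideal is its unique Gröbner basis consisting of monic polynomials such that no term of any element is divisible by the leading term of another element. *)

(* Defs.v *)
From mathcomp Require Import all_boot all_order all_algebra.
From mathcomp Require Export finmap mpoly.

Set Implicit Arguments.
Unset Strict Implicit.
Unset Printing Implicit Defensive.

Import Order.TTheory GRing.Theory.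

Local Open Scope ring_scope.

(** * Ideals and Groebner bases *)

Definition ideal_gen (R : comNzRingType) (S : R -> Prop) (f : R) : Prop :=
  exists2 s : seq (R * R), (forall t, t \in s -> S t.2)
    & f = \sum_(t <- s) t.1 * t.2.

Definition ideal_add (R : comNzRingType) (I J : R -> Prop) (f : R) : Prop :=
  exists f1 f2, [/\ I f1, J f2 & f = f1 + f2].

(* The order on 'X_{1..n} provided by mpoly compares total degrees first; this
   is the pure lexicographic order, with 'X_0 > 'X_1 > ... *)
Definition lexmn (n : nat) : rel 'X_{1..n} :=
  fun m1 m2 => ((m1 : seqlexi nat) <= (m2 : seqlexi nat))%O.

(* In the next definitions, [le] is meant to be a monomial order.  0 is then its
   least element, so that [lmon le f] is the [le]-greatest monomial of [f] if
   f != 0; moreover [lmon le 0 = 0] and [lterm le 0 = 0]. *)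
Definition lmon (K : fieldType) (n : nat) (le : rel 'X_{1..n})
    (f : {mpoly K[n]}) : 'X_{1..n} :=
  \big[(fun m1 m2 => if le m1 m2 then m2 else m1) / 0%MM]_(m <- msupp f) m.

Definition lcoef (K : fieldType) (n : nat) (le : rel 'X_{1..n})
    (f : {mpoly K[n]}) : K :=
  f@_(lmon le f).

Definition lterm (K : fieldType) (n : nat) (le : rel 'X_{1..n})
    (f : {mpoly K[n]}) : {mpoly K[n]} :=
  lcoef le f *: 'X_[lmon le f].

Definition leading_ideal (K : fieldType) (n : nat) (le : rel 'X_{1..n})
    (S : {mpoly K[n]} -> Prop) : {mpoly K[n]} -> Prop :=
  ideal_gen (fun t => exists2 f, S f & t = lterm le f).

Definition groebner_basis (K : fieldType) (n : nat) (le : rel 'X_{1..n})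
    (I : {mpoly K[n]} -> Prop) (G : {fset {mpoly K[n]}}) : Prop :=
  (forall g, g \in G -> I g)
  /\ (forall f, leading_ideal le (fun g => g \in G) f <-> leading_ideal le I f).

(* (m1 <= m2)%MM is divisibility of 'X_[m2] by 'X_[m1] *)
Definition reduced_groebner_basis (K : fieldType) (n : nat)
    (le : rel 'X_{1..n}) (I : {mpoly K[n]} -> Prop)
    (G : {fset {mpoly K[n]}}) : Prop :=
  [/\ groebner_basis le I G,
      forall g, g \in G -> lcoef le g = 1
    & forall g h, g \in G -> h \in G -> g != h ->
        forall m, m \in msupp g -> ~~ (lmon le h <= m)%MM].

(** * Linear codes *)

Definition generator_matrix (F : fieldType) (n k : nat)
    (C : {vspace 'rV[F]_n}) (A : 'M[F]_(k, n)) : Prop :=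
  basis_of C [seq row i A | i : 'I_k].

Definition standard_form (F : fieldType) (n k : nat) (le_kn : (k <= n)%N)
    (A : 'M[F]_(k, n)) : Prop :=
  exists M : 'M[F]_(k, n - k),
    A = castmx (erefl k, subnKC le_kn) (row_mx 1%:M M).

(** * The variables x_{ju}

   Rows and columns of variables are indexed from 0: j : 'I_n and u : 'I_p.-1
   stand for the variable x_{j+1,u+1}, whose second index is the exponent in
   alpha ^+ u.+1.  The variables are numbered row by row, so that [lexmn] orders
   them as x_{11} > x_{12} > ... > x_{n,p-1}. *)

Lemma var_idx_subproof (n q : nat) (j : 'I_n) (u : 'I_q) :
  (j * q + u < n * q)%N.
Proof.
apply: (@leq_trans (j.+1 * q)); last by rewrite leq_mul2r ltn_ord orbT.
by rewrite mulSn addnC ltn_add2r.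
Qed.

Definition var_idx (n q : nat) (j : 'I_n) (u : 'I_q) : 'I_(n * q) :=
  Ordinal (var_idx_subproof j u).

Lemma last_col_subproof (p : nat) : prime p -> (p.-2 < p.-1)%N.
Proof. by case: p => [|[|p]]. Qed.

(* the column of the variables x_{j,p-1} *)
Definition last_col (p : nat) (p_pr : prime p) : 'I_p.-1 :=
  Ordinal (last_col_subproof p_pr).

Definition var (K : fieldType) (n p : nat) (j : 'I_n) (u : 'I_p.-1) :
    {mpoly K[n * p.-1]} :=
  'X_(var_idx j u).

(* The elements of 'F_p are ordinals (below p when p is prime), which are
   coerced to nat when used as exponents. *)
Definition last_monomial (K : fieldType) (n p : nat) (p_pr : prime p)
    (m : 'rV['F_p]_n) : {mpoly K[n * p.-1]} :=
  \prod_(j < n) var K j (last_col p_pr) ^+ (m 0 j : nat).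

(** * The generalized code ideal *)

(* For alpha primitive, at most one u satisfies a_j = alpha^(u+1). *)
Definition crossing (n p : nat) (alpha : 'F_p) (a : 'rV['F_p]_n) :
    'X_{1..n * p.-1} :=
  (\sum_(j < n) \sum_(u < p.-1 | a 0%R j == alpha ^+ u.+1)
     U_(var_idx j u))%MM.

Definition Iq_gens (K : fieldType) (n p : nat) (alpha : 'F_p)
    (f : {mpoly K[n * p.-1]}) : Prop :=
  (exists (j : 'I_n) (u v w : 'I_p.-1),
     alpha ^+ u.+1 + alpha ^+ v.+1 = alpha ^+ w.+1
     /\ f = var K j u * var K j v - var K j w)
  \/ (exists (j : 'I_n) (u v : 'I_p.-1),
     alpha ^+ u.+1 + alpha ^+ v.+1 = 0
     /\ f = var K j u * var K j v - 1).

Definition code_binomials (K : fieldType) (n p : nat) (alpha : 'F_p)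
    (C : {vspace 'rV['F_p]_n}) (f : {mpoly K[n * p.-1]}) : Prop :=
  exists a b : 'rV['F_p]_n,
    a - b \in C /\ f = 'X_[crossing alpha a] - 'X_[crossing alpha b].

Definition code_ideal (K : fieldType) (n p : nat) (alpha : 'F_p)
    (C : {vspace 'rV['F_p]_n}) : {mpoly K[n * p.-1]} -> Prop :=
  ideal_add (ideal_gen (code_binomials alpha C)) (ideal_gen (Iq_gens alpha)).

(** * The explicit basis *)

Definition mvec (n k p : nat) (le_kn : (k <= n)%N) (alpha : 'F_p)
    (A : 'M['F_p]_(k, n)) (i : 'I_k) (j : 'I_p.-1) : 'rV['F_p]_n :=
  alpha ^+ j.+1 *: (delta_mx 0 (widen_ord le_kn i) - row i A).

Definition explicit_basis (K : fieldType) (n k p : nat) (p_pr : prime p)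
    (le_kn : (k <= n)%N) (alpha : 'F_p) (A : 'M['F_p]_(k, n)) :
    {fset {mpoly K[n * p.-1]}} :=
  ([fset var K (widen_ord le_kn i) j
         - last_monomial K p_pr (mvec le_kn alpha A i j)
     | i : 'I_k, j : 'I_p.-1]
   `|` [fset var K i j - var K i (last_col p_pr) ^+ (alpha ^+ j.+1 : 'F_p)
         | i in [pred i : 'I_n | (k <= i)%N],
           j in [pred j : 'I_p.-1 | (j.+1 <= p.-2)%N]]
   `|` [fset var K i (last_col p_pr) ^+ p - 1
         | i in [pred i : 'I_n | (k <= i)%N]])%fset.

(* Main.v *)
Require Import Defs.
From mathcomp Require Import all_boot all_order all_algebra.
From mathcomp Require Import finfield finmap mpoly.

(** Every monomial x^m has a weight wt m in F_p^n, obtained by reading the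
    variable x_{ju} as the vector alpha^u e_j.  Weights add up under products of
    monomials, and the generators of the code ideal I are binomials x^a - x^b
    whose weights agree modulo C.  Conversely x^a - x^b lies in I as
    soon as wt a - wt b is in C ([code_ideal_binomial]): modulo I_q each monomial
    equals the squarefree monomial that the crossing map attaches to its weight.
    So I identifies two monomials exactly when their weights lie in the same
    coset of C; below, the coset of a monomial means that of its weight.

    Since the generator matrix is in standard form, each coset of C has exactly
    one element that vanishes on the first k coordinates.  Writing this element
    c as the product of the x_{j,p-1}^{c_j}, whose weight is c because
    alpha^{p-1} = 1, gives a normal form N(m) for x^m, depending only on the
    coset.  The central fact is that N(m) is the lexicographically least
    monomial of its coset ([normal_mnm_le]).

    Suppose now that f in I has its leading monomial M in normal form.  The
    coefficients of f in any one coset add up to 0, as this holds for the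
    generators and their multiples ([class_sum_ideal]); so f has another
    monomial in the coset of M, and it is larger than M, a contradiction.  Hence
    the leading monomials of I are exactly the monomials that are not in normal
    form, and the reduced Groebner basis consists of the b - N(b), where b
    runs through the minimal ones among them ([reduced_groebner_normal_form]).
    These are the variables other than x_{i,p-1} with i > k, and the powers
    x_{i,p-1}^p with i > k ([normal_mnm_corner]); the corresponding binomials are
    the three families of the explicit basis ([explicit_basisE]).

    Uniqueness is the classical argument: two reduced bases have the same
    leading monomials, and the difference of two elements with the same leading
    monomial would have a leading monomial divisible by that of a basis element,
    which reducedness forbids ([reduced_groebner_basis_sub]). *)

Set Implicit Arguments.
Unset Strict Implicit.
Unset Printing Implicit Defensive.

Import Order.TTheory GRing.Theory.

Local Open Scope ring_scope.

(** * Ideals given by generators *)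

Lemma ideal_gen_mem (R : comNzRingType) (S : R -> Prop) g :
  S g -> ideal_gen S g.
Proof.
move=> Sg; exists [:: (1, g)]; first by move=> t /[!inE]/eqP->.
by rewrite big_seq1 mul1r.
Qed.

Lemma ideal_gen0 (R : comNzRingType) (S : R -> Prop) : ideal_gen S 0.
Proof. by exists [::]; rewrite ?big_nil. Qed.

Lemma ideal_genD (R : comNzRingType) (S : R -> Prop) f g :
  ideal_gen S f -> ideal_gen S g -> ideal_gen S (f + g).
Proof.
move=> [s Ss ->] [t St ->]; exists (s ++ t); last by rewrite big_cat.
by move=> u; rewrite mem_cat => /orP[/Ss|/St].
Qed.

Lemma ideal_genM (R : comNzRingType) (S : R -> Prop) q f :
  ideal_gen S f -> ideal_gen S (q * f).
Proof.
move=> [s Ss ->]; exists [seq (q * t.1, t.2) | t <- s].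
  by move=> u /mapP[t /Ss St ->].
by rewrite big_map mulr_sumr; apply: eq_bigr => t _ /=; rewrite mulrA.
Qed.

Lemma ideal_genB (R : comNzRingType) (S : R -> Prop) f g :
  ideal_gen S f -> ideal_gen S g -> ideal_gen S (f - g).
Proof.
by move=> If Ig; apply: ideal_genD => //; rewrite -mulN1r; apply: ideal_genM.
Qed.

Lemma ideal_gen_sub (R : comNzRingType) (S T : R -> Prop) :
    (forall g, S g -> ideal_gen T g) ->
  forall f, ideal_gen S f -> ideal_gen T f.
Proof.
move=> subST f [s Ss ->]; elim: s Ss => [|t s IHs] Ss.
  by rewrite big_nil; apply: ideal_gen0.
rewrite big_cons; apply: ideal_genD.
  by apply/ideal_genM/subST/Ss; rewrite mem_head.
by apply: IHs => u su; apply: Ss; rewrite inE su orbT.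
Qed.

Lemma ideal_add_gen (R : comNzRingType) (S T : R -> Prop) f :
  ideal_add (ideal_gen S) (ideal_gen T) f
  <-> ideal_gen (fun g => S g \/ T g) f.
Proof.
split=> [[f1 [f2 [If1 If2 ->]]]|[s STs ->]].
  apply: ideal_genD.
    by apply: ideal_gen_sub If1 => g Sg; apply: ideal_gen_mem; left.
  by apply: ideal_gen_sub If2 => g Tg; apply: ideal_gen_mem; right.
elim: s STs => [|t s IHs] STs.
  by exists 0, 0; split; rewrite ?big_nil ?addr0 //; apply: ideal_gen0.
have [|f1 [f2 [If1 If2 Ef]]] := IHs.
  by move=> u su; apply: STs; rewrite inE su orbT.
rewrite big_cons Ef; have [|St|Tt] := STs t; first by rewrite mem_head.
  exists (t.1 * t.2 + f1), f2; split; rewrite ?addrA //.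
  by apply/ideal_genD/If1/ideal_genM/ideal_gen_mem.
exists f1, (t.1 * t.2 + f2); split; rewrite 1?addrCA //.
by apply/ideal_genD/If2/ideal_genM/ideal_gen_mem.
Qed.

(** * Leading monomials *)

(** For such an order 0 is the least monomial, and the leading monomial of f
    divides no other monomial of f. *)
Definition divisibility_extension (n : nat) (le : rel 'X_{1..n}) : Prop :=
  [/\ total le, transitive le, antisymmetric le
    & forall m1 m2, (m1 <= m2)%MM -> le m1 m2].

Lemma le0_divext (n : nat) (le : rel 'X_{1..n}) m :
  divisibility_extension le -> le 0%MM m.
Proof. by case=> _ _ _; apply; apply/mnm_lepP => i; rewrite mnm0E. Qed.

(** The fold that defines the leading monomial starts from the monomial 0, which
    need not be in the support; as 0 is the least monomial, it never survives
    the first comparison with a monomial of f other than 0 itself. *)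
Lemma lmon_spec (K : fieldType) (n : nat) (le : rel 'X_{1..n})
    (f : {mpoly K[n]}) :
    divisibility_extension le -> f != 0 ->
  lmon le f \in msupp f /\ {in msupp f, forall m, le m (lmon le f)}.
Proof.
move=> ext; rewrite -msupp_eq0 /lmon; elim: (msupp f) => // m s IHs _.
have le0 x : le 0%MM x by apply: le0_divext.
case: ext => tot tr anti _; have le_refl x : le x x by case/orP: (tot x x).
rewrite big_cons; have [->|/IHs[]] := eqVneq s [::].
  rewrite big_nil.
  suff ->: (if le m 0%MM then 0%MM else m) = m.
    by rewrite inE eqxx; split=> // x /[!inE]/eqP->.
  by case: ifP => // m0; apply: anti; rewrite m0 le0.
set M := \big[_/_]_(x <- s) x => sM maxM; case: ifPn => mM.
  split; first by rewrite inE sM orbT.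
  by move=> x /[!inE]/predU1P[->|/maxM].
split=> [|x]; first exact: mem_head.
have Mm: le M m by case/orP: (tot M m); rewrite // (negPf mM).
by move=> /[!inE]/predU1P[->//|/maxM xM]; apply: tr Mm.
Qed.

Lemma lcoef_eq0 (K : fieldType) (n : nat) (le : rel 'X_{1..n})
    (f : {mpoly K[n]}) :
  divisibility_extension le -> (lcoef le f == 0) = (f == 0).
Proof.
move=> ext; have [->|f0] := eqVneq f 0; first by rewrite /lcoef mcoeff0 eqxx.
by apply: negbTE; rewrite -mcoeff_msupp; case: (lmon_spec ext f0).
Qed.

(** A leading ideal is a monomial ideal, and a monomial occurring in an element
    of a monomial ideal is a multiple of one of the generating monomials.  The
    conclusion lcoef le g != 0 discards g = 0, whose leading term generates
    nothing. *)
Lemma leading_ideal_supp (K : fieldType) (n : nat) (le : rel 'X_{1..n})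
    (S : {mpoly K[n]} -> Prop) f m :
    leading_ideal le S f -> m \in msupp f ->
  exists2 g, S g & lcoef le g != 0 /\ (lmon le g <= m)%MM.
Proof.
case=> s Ss ->; elim: s Ss => [|t s IHs] Ss.
  by rewrite big_nil msupp0.
rewrite big_cons => /msuppD_le; rewrite mem_cat => /orP[|sm]; last first.
  by apply: IHs sm => u su; apply: Ss; rewrite inE su orbT.
have [g Sg ->] := Ss t (mem_head _ _).
rewrite /lterm -scalerAr => tm; exists g => //.
have g0: lcoef le g != 0.
  by apply/eqP => g0; move: tm; rewrite g0 scale0r msupp0.
move: tm => /msuppZ_le; rewrite (perm_mem (msuppMX _ _)) => /mapP[m' _ ->].
by split=> //; apply/mnm_lepP => i; rewrite mnmDE leq_addr.
Qed.

Lemma leading_ideal_div (K : fieldType) (n : nat) (le : rel 'X_{1..n})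
    (S : {mpoly K[n]} -> Prop) f g :
    S g -> lcoef le g = 1 -> (lmon le g <= lmon le f)%MM ->
  leading_ideal le S (lterm le f).
Proof.
move=> Sg g1 gf; rewrite /lterm -(submK gf) mpolyXD scalerAl.
apply/ideal_genM/ideal_gen_mem; exists g => //.
by rewrite /lterm g1 scale1r.
Qed.

(** * Reduced Groebner bases *)

Lemma groebner_basis_div (K : fieldType) (n : nat) (le : rel 'X_{1..n})
    (I : {mpoly K[n]} -> Prop) G f :
    divisibility_extension le -> groebner_basis le I G -> I f -> f != 0 ->
  exists2 g, g \in G & (lmon le g <= lmon le f)%MM.
Proof.
move=> ext [_ GB] If f0.
have /GB LT: leading_ideal le I (lterm le f).
  by apply: ideal_gen_mem; exists f.
have [|g Gg [_ gf]] := leading_ideal_supp (m := lmon le f) LT; last by exists g.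
by rewrite msuppMCX ?mem_head // lcoef_eq0.
Qed.

(** An element g of G and its divisor h in H have the same leading monomial,
    because some g' in G in turn has its leading monomial dividing that of h,
    and g' = g as G is reduced.  Then g - h = 0: its leading monomial would
    occur in g or in h, and reducedness leaves no monomial of g or h other than
    the leading one that is a leading monomial of I. *)
Lemma reduced_groebner_basis_sub (K : fieldType) (n : nat)
    (le : rel 'X_{1..n}) (I : {mpoly K[n]} -> Prop) G H :
    divisibility_extension le -> (forall f g, I f -> I g -> I (f - g)) ->
    reduced_groebner_basis le I G -> reduced_groebner_basis le I H ->
  {subset G <= H}.
Proof.
move=> ext IB [GBG G1 redG] [GBH H1 redH] g Gg.
have neq0 (E : {fset {mpoly K[n]}}) f :
    (forall x, x \in E -> lcoef le x = 1) -> f \in E -> f != 0.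
  by move=> E1 /E1 f1; rewrite -(lcoef_eq0 _ ext) f1 oner_eq0.
have g0 := neq0 _ _ G1 Gg; have [sg maxg] := lmon_spec ext g0.
have [h Hh hg] := groebner_basis_div ext GBH (GBG.1 _ Gg) g0.
have h0 := neq0 _ _ H1 Hh; have [sh maxh] := lmon_spec ext h0.
have [g' Gg' g'h] := groebner_basis_div ext GBG (GBH.1 _ Hh) h0.
have Eg: g' = g.
  apply/eqP; rewrite eq_sym; apply: contraT => /(redG _ _ Gg Gg')/(_ _ sg).
  by rewrite (lepm_trans g'h hg).
have [_ tr anti div] := ext.
have lm_eq: lmon le h = lmon le g.
  by apply: anti; rewrite !div // -Eg.
suff /eqP: g - h = 0 by rewrite subr_eq0 => /eqP->.
apply/eqP; apply: contraT => gh0; have [sgh _] := lmon_spec ext gh0.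
have Igh: I (g - h) by apply: IB; [apply: GBG.1 | apply: GBH.1].
(* In the support of g or h, reducedness only leaves their common leading
   monomial for that of g - h, and there the coefficients 1 cancel. *)
have no_lead (E : {fset {mpoly K[n]}}) f :
    (forall x y, x \in E -> y \in E -> x != y ->
       forall m, m \in msupp x -> ~~ (lmon le y <= m)%MM) ->
    groebner_basis le I E -> f \in E -> lmon le f = lmon le g ->
    {in msupp f, forall m, le m (lmon le f)} ->
    lmon le (g - h) \notin msupp f.
  move=> redE GBE Ef lmf maxf; apply/negP => sf.
  have [e Ee egh] := groebner_basis_div ext GBE Igh gh0.
  have ef: e = f.
    by apply/eqP; rewrite eq_sym; apply: contraT => /(redE _ _ Ef Ee)/(_ _ sf);
      rewrite egh.
  have E1: lmon le (g - h) = lmon le f.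
    by apply: anti; rewrite maxf //= div // -ef.
  move: sgh; rewrite E1 lmf mcoeff_msupp mcoeffB -{2}lm_eq.
  by rewrite -/(lcoef le g) -/(lcoef le h) G1 // H1 // subrr eqxx.
move: (msuppB_le sgh); rewrite mem_cat.
by case/orP; apply: contraLR => _; [apply: (no_lead G) | apply: (no_lead H)].
Qed.

Lemma reduced_groebner_basis_uniq (K : fieldType) (n : nat)
    (le : rel 'X_{1..n}) (I : {mpoly K[n]} -> Prop) G H :
    divisibility_extension le -> (forall f g, I f -> I g -> I (f - g)) ->
    reduced_groebner_basis le I G -> reduced_groebner_basis le I H ->
  G = H.
Proof.
move=> ext IB redG redH; apply/fsetP => f.
by apply/idP/idP; apply: (reduced_groebner_basis_sub ext IB).
Qed.

(** * Ideals of binomials constant on classes *)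

Definition class_sum (K : fieldType) (n : nat) (T : eqType)
    (kappa : 'X_{1..n} -> T) (c : T) (f : {mpoly K[n]}) : K :=
  \sum_(m <- msupp f | kappa m == c) f@_m.

(** Summing over any list containing the support allows the class sums of
    several polynomials to be taken over a common list. *)
Lemma class_sum_widen (K : fieldType) (n : nat) (T : eqType)
    (kappa : 'X_{1..n} -> T) c (f : {mpoly K[n]}) s :
    uniq s -> {subset msupp f <= s} ->
  class_sum kappa c f = \sum_(m <- s | kappa m == c) f@_m.
Proof.
move=> s_uniq fs.
rewrite [RHS](bigID (mem (msupp f))) /= [X in _ + X]big1 ?addr0; last first.
  by move=> m /andP[_] /memN_msupp_eq0.
under eq_bigl do rewrite andbC.
rewrite -big_filter_cond; apply/perm_big/uniq_perm.
- exact: msupp_uniq.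
- exact: filter_uniq.
by move=> m; rewrite mem_filter; case fm: (m \in _); rewrite // (fs _ fm).
Qed.

Lemma class_sumD (K : fieldType) (n : nat) (T : eqType)
    (kappa : 'X_{1..n} -> T) c (f g : {mpoly K[n]}) :
  class_sum kappa c (f + g) = class_sum kappa c f + class_sum kappa c g.
Proof.
pose s := undup (msupp f ++ msupp g).
rewrite !(@class_sum_widen _ _ _ _ _ _ s) ?undup_uniq //;
  do ?[by move=> m; rewrite mem_undup ?mem_cat => ->; rewrite ?orbT].
  by rewrite -big_split; apply: eq_bigr => m _ /=; rewrite mcoeffD.
by move=> m /msuppD_le; rewrite mem_undup.
Qed.

Lemma class_sumZX (K : fieldType) (n : nat) (T : eqType)
    (kappa : 'X_{1..n} -> T) c (a : K) m :
  class_sum kappa c (a *: 'X_[m]) = if kappa m == c then a else 0.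
Proof.
rewrite (@class_sum_widen _ _ _ _ _ _ [:: m]) //; last first.
  by move=> x /msuppZ_le; rewrite msuppX.
by rewrite big_mkcond big_seq1 mcoeffZ mcoeffX eqxx mulr1.
Qed.

Lemma class_sum0 (K : fieldType) (n : nat) (T : eqType)
    (kappa : 'X_{1..n} -> T) c :
  class_sum kappa c (0 : {mpoly K[n]}) = 0.
Proof. by rewrite /class_sum msupp0 big_nil. Qed.

(** Multiplying x^a - x^b by a monomial keeps both terms in one class, so the
    class sums, which are linear, vanish on all multiples of the generators. *)
Lemma class_sum_ideal (K : fieldType) (n : nat) (T : eqType)
    (kappa : 'X_{1..n} -> T) (S : {mpoly K[n]} -> Prop) :
    (forall m a b, kappa a = kappa b -> kappa (m + a)%MM = kappa (m + b)%MM) ->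
    (forall g, S g ->
       exists a b, kappa a = kappa b /\ g = 'X_[a] - 'X_[b]) ->
  forall f c, ideal_gen S f -> class_sum kappa c f = 0.
Proof.
move=> kappaD binS f c [s Ss ->]; elim: s Ss => [|t s IHs] Ss.
  by rewrite big_nil class_sum0.
rewrite big_cons class_sumD IHs ?addr0; last first.
  by move=> u su; apply: Ss; rewrite inE su orbT.
have [a [b [kab ->]]] := binS _ (Ss t (mem_head _ _)).
rewrite [t.1]mpolyE; elim: (msupp t.1) => [|m r IHr].
  by rewrite big_nil mul0r class_sum0.
rewrite big_cons mulrDl class_sumD IHr addr0 -scalerAl mulrBr -!mpolyXD.
rewrite scalerBr -scaleNr class_sumD !class_sumZX (kappaD m a b kab).
by case: ifP; rewrite ?subrr ?addr0.
Qed.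

Lemma lmon_binomial (K : fieldType) (n : nat) (le : rel 'X_{1..n}) a b :
    divisibility_extension le -> le a b -> a != b ->
  lmon le ('X_[b] - 'X_[a] : {mpoly K[n]}) = b.
Proof.
move=> ext ab neq; have Eb: ('X_[b] - 'X_[a] : {mpoly K[n]})@_b = 1.
  by rewrite mcoeffB !mcoeffX eqxx (negPf neq) subr0.
have sb: b \in msupp ('X_[b] - 'X_[a] : {mpoly K[n]}).
  by rewrite mcoeff_msupp Eb oner_eq0.
have [|] := lmon_spec (f := 'X_[b] - 'X_[a] : {mpoly K[n]}) ext.
  by apply/eqP => f0; move/eqP: Eb; rewrite f0 mcoeff0 eq_sym oner_eq0.
move=> /msuppB_le; rewrite mem_cat !msuppX !inE => /orP[]/eqP-> // /(_ b sb) ba.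
by case: ext => _ _ anti _; apply: anti; rewrite ab.
Qed.

(** A criterion that replaces S-polynomials and division: nf picks the least
    monomial of each class, and B is the set of those monomials that are not
    their own normal form and are minimal for divisibility. *)
Lemma reduced_groebner_normal_form (K : fieldType) (n : nat)
    (le : rel 'X_{1..n}) (I : {mpoly K[n]} -> Prop)
    (nf : 'X_{1..n} -> 'X_{1..n}) (B : 'X_{1..n} -> Prop)
    (G : {fset {mpoly K[n]}}) :
    divisibility_extension le ->
    (forall m, le (nf m) m) -> (forall m, nf (nf m) = nf m) ->
    (forall m, I ('X_[m] - 'X_[nf m])) ->
    (forall f c, I f -> class_sum nf c f = 0) ->
    (forall m, nf m != m <-> exists2 b, B b & (b <= m)%MM) ->
    (forall a b, B a -> B b -> (a <= b)%MM -> a = b) ->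
    (forall g, g \in G <-> exists2 b, B b & g = 'X_[b] - 'X_[nf b]) ->
  reduced_groebner_basis le I G.
Proof.
move=> ext nf_le nfK Inf sumI std antichain inG.
have nfB b: B b -> nf b != b by move=> Bb; apply/std; exists b => //; apply: lepm_refl.
have lmG b: B b -> lmon le ('X_[b] - 'X_[nf b] : {mpoly K[n]}) = b.
  by move=> Bb; rewrite lmon_binomial ?nfB.
have G1 g: g \in G -> lcoef le g = 1.
  move=> /inG[b Bb ->]; rewrite /lcoef lmG // mcoeffB !mcoeffX eqxx.
  by rewrite (negPf (nfB b Bb)) subr0.
have GI g: g \in G -> I g by move=> /inG[b _ ->].
split=> //.
- split=> // f; split; apply: ideal_gen_sub => _ [g Gg ->].
    by apply: ideal_gen_mem; exists g => //; apply: GI.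
  have [->|g0] := eqVneq g 0.
    by rewrite /lterm /lcoef mcoeff0 scale0r; apply: ideal_gen0.
  have [sg maxg] := lmon_spec ext g0; set M := lmon le g in sg maxg.
  suff /std[b Bb bM] : nf M != M.
    by apply: (@leading_ideal_div _ _ _ _ _ ('X_[b] - 'X_[nf b]));
      rewrite ?G1 ?lmG //; apply/inG; exists b.
  (* if M were in normal form, no other monomial of g would be in its class *)
  apply/eqP => nfM; have /eqP := sumI g M Gg.
  rewrite /class_sum big_mkcond (bigD1_seq M) ?msupp_uniq //= nfM eqxx.
  rewrite big1_seq ?addr0 ?mcoeff_eq0 ?sg // => m /andP[mM sm].
  case: eqP => // nfm; case: ext => _ _ anti _.
  by rewrite (anti m M) ?eqxx // in mM; rewrite maxg //= -nfm nf_le.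
move=> g h /inG[a Ba ->] /inG[b Bb ->] neq m.
rewrite lmG // => /msuppB_le; rewrite mem_cat !msuppX !inE.
case/orP=> /eqP->; apply/negP => ba.
  by move: neq; rewrite (antichain _ _ Bb Ba ba) eqxx.
by have: nf (nf a) != nf a by [apply/std; exists b]; rewrite nfK eqxx.
Qed.

(** * The lexicographic order *)

Lemma lexmnPn (n : nat) (m1 m2 : 'X_{1..n}) :
    ~~ lexmn m1 m2 ->
  exists2 t : 'I_n, (forall s : 'I_n, (s < t)%N -> m1 s = m2 s)
    & (m2 t < m1 t)%N.
Proof.
rewrite /lexmn -ltNge => lt21.
pose disp := Order.seqlexi_display Order.NatOrder.nat_display.
have /(@ltxi_tuplePlt _ disp n nat m2 m1)[t eqt ltt] := lt21.
by exists t => [s /eqt/esym|]; rewrite !mnm_tnth.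
Qed.

Lemma lexmn_divext (n : nat) : divisibility_extension (@lexmn n).
Proof.
split=> [m1 m2|m2 m1 m3|m1 m2|m1 m2 /mnm_lepP m12]; rewrite /lexmn.
- exact: le_total.
- exact: le_trans.
- move=> /le_anti eq12; exact/val_inj/val_inj.
by apply: contraT => /lexmnPn[t _]; rewrite ltnNge m12.
Qed.

(** * Numbering of the variables *)

Lemma var_idx_eq (n q : nat) (j j' : 'I_n) (u u' : 'I_q) :
  (var_idx j u == var_idx j' u') = (j == j') && (u == u').
Proof.
apply/idP/idP => [/eqP/(congr1 val)/= E|/andP[/eqP-> /eqP->] //].
have q0 : (0 < q)%N by apply: leq_ltn_trans (ltn_ord u).
have := congr1 (divn^~ q) E; have := congr1 (modn^~ q) E.
rewrite !modnMDl !modn_small ?ltn_ord // !divnMDl // !divn_small ?ltn_ord //.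
by rewrite !addn0 => /val_inj-> /val_inj->; rewrite !eqxx.
Qed.

Lemma var_idx_surj (n q : nat) (t : 'I_(n * q)) : exists j u, t = var_idx j u.
Proof.
have q0 : (0 < q)%N by case: (q) t => // -[]; rewrite muln0.
have ltj : (t %/ q < n)%N by rewrite ltn_divLR.
exists (Ordinal ltj), (Ordinal (ltn_pmod t q0)).
by apply: val_inj; rewrite /= -divn_eq.
Qed.

Lemma var_idx_lt (n q : nat) (j j' : 'I_n) (u u' : 'I_q) :
  (j < j')%N || (j == j') && (u < u')%N -> (var_idx j u < var_idx j' u')%N.
Proof.
case/orP=> [ltj|/andP[/eqP-> ltu]] /=; last by rewrite ltn_add2l.
apply: leq_trans (leq_addr _ _); apply: (@leq_trans (j.+1 * q)).
  by rewrite mulSn addnC ltn_add2r.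
by rewrite leq_mul2r ltj orbT.
Qed.

Lemma mnm_var_ind (n : nat) (P : 'X_{1..n} -> Prop) :
    P 0%MM -> (forall m i, P m -> P (m + U_(i))%MM) ->
  forall m, P m.
Proof.
move=> P0 PU m; rewrite [m]multinomUE_id; elim/big_rec: _ => // i x _ Px.
elim: (m i) => [|e IHe]; first by rewrite mulm0n add0m.
by rewrite mulmS -addmA addmC; apply: PU.
Qed.

(** * Discrete logarithms in F_p *)

Lemma Fp_prim_root_neq0 (p : nat) (alpha : 'F_p) :
  prime p -> p.-1.-primitive_root alpha -> alpha != 0.
Proof.
by move=> p_pr prim; rewrite (prim_root_eq0 prim); case: p p_pr {alpha prim} => [|[]].
Qed.

Lemma Fp_prim_root_log (p : nat) (alpha c : 'F_p) :
    prime p -> p.-1.-primitive_root alpha -> c != 0 ->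
  exists u : 'I_p.-1, c = alpha ^+ u.+1.
Proof.
move=> p_pr prim c0; have a0 := Fp_prim_root_neq0 p_pr prim.
have ca0 : c / alpha != 0 by rewrite mulf_neq0 ?invr_eq0.
have [|u Eu] := prim_rootP prim (x := c / alpha); last first.
  by exists u; rewrite exprSr -Eu divfK.
apply: (mulfI ca0); rewrite -exprS mulr1 prednK ?prime_gt0 //.
by have := expf_card (c / alpha); rewrite card_Fp.
Qed.

Lemma prim_root_expS_inj (p : nat) (alpha : 'F_p) (u v : 'I_p.-1) :
    p.-1.-primitive_root alpha ->
  (alpha ^+ u.+1 == alpha ^+ v.+1) = (u == v).
Proof.
move=> prim; rewrite (eq_prim_root_expr prim) -add1n -[v.+1]add1n.
by rewrite eqn_modDl !modn_small.
Qed.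

(** * Weights of monomials *)

Definition wt (n p : nat) (alpha : 'F_p) (m : 'X_{1..n * p.-1}) :
    'rV['F_p]_n :=
  \row_j \sum_(u < p.-1) alpha ^+ u.+1 *+ m (var_idx j u).

Lemma wtD (n p : nat) (alpha : 'F_p) (m1 m2 : 'X_{1..n * p.-1}) :
  wt alpha (m1 + m2)%MM = wt alpha m1 + wt alpha m2.
Proof.
apply/rowP => j; rewrite !mxE -big_split; apply: eq_bigr => u _ /=.
by rewrite mnmDE mulrnDr.
Qed.

Lemma wt0 (n p : nat) (alpha : 'F_p) : wt alpha (0%MM : 'X_{1..n * p.-1}) = 0.
Proof. by apply/rowP => j; rewrite !mxE big1 // => u _; rewrite mnm0E. Qed.

Lemma wtMn (n p : nat) (alpha : 'F_p) (m : 'X_{1..n * p.-1}) e :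
  wt alpha (m *+ e)%MM = wt alpha m *+ e.
Proof.
elim: e => [|e IHe]; first by rewrite mulm0n wt0.
by rewrite mulmS wtD IHe mulrS.
Qed.

Lemma wt_sum (n p : nat) (alpha : 'F_p) (J : Type) (r : seq J) (P : pred J)
    (F : J -> 'X_{1..n * p.-1}) :
  wt alpha (\sum_(j <- r | P j) F j)%MM = \sum_(j <- r | P j) wt alpha (F j).
Proof. by rewrite (big_morph _ (@wtD n p alpha) (wt0 n alpha)). Qed.

Lemma wtU (n p : nat) (alpha : 'F_p) (j : 'I_n) (u : 'I_p.-1) :
  wt alpha U_(var_idx j u)%MM = alpha ^+ u.+1 *: delta_mx 0 j.
Proof.
apply/rowP => j'; rewrite !mxE eqxx /= (bigD1 u) //= big1 ?addr0.
  by rewrite mnm1E var_idx_eq eqxx andbT [j' == j]eq_sym mulr_natr.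
by move=> v vu; rewrite mnm1E var_idx_eq [u == v]eq_sym (negPf vu) andbF.
Qed.

(** The block of the crossing map that comes from one coordinate, as an exponent
    vector in all the variables. *)
Definition row_crossing (n p : nat) (alpha : 'F_p) (j : 'I_n) (c : 'F_p) :
    'X_{1..n * p.-1} :=
  (\sum_(u < p.-1 | c == alpha ^+ u.+1) U_(var_idx j u))%MM.

Lemma row_crossing0 (n p : nat) (alpha : 'F_p) (j : 'I_n) :
  prime p -> p.-1.-primitive_root alpha -> row_crossing alpha j 0 = 0%MM.
Proof.
move=> p_pr prim; rewrite /row_crossing big_pred0 // => u.
by rewrite eq_sym expf_eq0 (negPf (Fp_prim_root_neq0 p_pr prim)) andbF.
Qed.

Lemma row_crossingX (n p : nat) (alpha : 'F_p) (j : 'I_n) (u : 'I_p.-1) :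
    p.-1.-primitive_root alpha ->
  row_crossing alpha j (alpha ^+ u.+1) = U_(var_idx j u)%MM.
Proof.
move=> prim; rewrite /row_crossing (big_pred1 u) // => v.
by rewrite prim_root_expS_inj // eq_sym.
Qed.

Lemma wt_crossing (n p : nat) (alpha : 'F_p) (a : 'rV['F_p]_n) :
  prime p -> p.-1.-primitive_root alpha -> wt alpha (crossing alpha a) = a.
Proof.
move=> p_pr prim; rewrite [RHS]row_sum_delta wt_sum; apply: eq_bigr => j _.
rewrite -/(row_crossing alpha j (a 0 j)).
have [->|/(Fp_prim_root_log p_pr prim)[u ->]] := eqVneq (a 0 j) 0.
  by rewrite row_crossing0 // wt0 scale0r.
by rewrite row_crossingX // wtU.
Qed.

(** * Binomials in the code ideal *)

(** The generators of I_q are an addition table: they turn the product of the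
    variables for c and alpha^u into the variable for c + alpha^u, or into 1 if
    this sum is 0. *)
Lemma row_crossing_mulX (K : fieldType) (n p : nat) (alpha : 'F_p) (j : 'I_n)
    (c : 'F_p) (u : 'I_p.-1) :
    prime p -> p.-1.-primitive_root alpha ->
  ideal_gen (Iq_gens (K := K) alpha)
    ('X_[row_crossing alpha j c + U_(var_idx j u)]
     - 'X_[row_crossing alpha j (c + alpha ^+ u.+1)]).
Proof.
move=> p_pr prim; have log := Fp_prim_root_log p_pr prim.
have [->|/log[v ->]] := eqVneq c 0.
  rewrite row_crossing0 // !add0r row_crossingX // add0m subrr.
  exact: ideal_gen0.
rewrite row_crossingX // mpolyXD; apply: ideal_gen_mem.
have [E|/log[w E]] := eqVneq (alpha ^+ v.+1 + alpha ^+ u.+1) 0.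
  by right; exists j, v, u; rewrite E row_crossing0 // mpolyX0.
by left; exists j, v, u, w; rewrite E row_crossingX.
Qed.

(** Multiplying x^m by x_{ju} changes the weight in coordinate j only, so that one
    application of the addition table in block j repairs the crossing. *)
Lemma mpolyX_crossing (K : fieldType) (n p : nat) (alpha : 'F_p)
    (m : 'X_{1..n * p.-1}) :
    prime p -> p.-1.-primitive_root alpha ->
  ideal_gen (Iq_gens (K := K) alpha)
    ('X_[m] - 'X_[crossing alpha (wt alpha m)]).
Proof.
move=> p_pr prim; elim/mnm_var_ind: m => [|m t IHm].
  rewrite wt0 /crossing big1 ?subrr; first exact: ideal_gen0.
  by move=> j _; rewrite mxE -[LHS]/(row_crossing alpha j 0) row_crossing0.
have [j [u ->]] := var_idx_surj t; rewrite wtD wtU; set a := wt alpha m in IHm *.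
pose rest := (\sum_(i < n | i != j) row_crossing alpha i (a 0%R i))%MM.
have Ea : crossing alpha a = (rest + row_crossing alpha j (a 0%R j))%MM.
  by rewrite /crossing (bigD1 j) //= addmC.
have Eau : crossing alpha (a + alpha ^+ u.+1 *: delta_mx 0 j)
    = (rest + row_crossing alpha j (a 0%R j + alpha ^+ u.+1)%R)%MM.
  rewrite /crossing (bigD1 j) //= addmC; congr (_ + _)%MM.
    apply: eq_bigr => i ij.
    by rewrite !mxE eqxx (negPf ij) mulr0 addr0.
  by rewrite !mxE !eqxx mulr1.
rewrite mpolyXD -[X in X - _](subrK ('X_[crossing alpha a] * 'X_(var_idx j u))).
rewrite -mulrBl -addrA mulrC; apply: ideal_genD; first exact: ideal_genM.
rewrite Ea Eau -!mpolyXD -addmA !(mpolyXD _ rest) -mulrBr.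
exact/ideal_genM/row_crossing_mulX.
Qed.

(** A single generating set for the sum of the two ideals in [code_ideal], see
    [ideal_add_gen]. *)
Definition code_ideal_gens (K : fieldType) (n p : nat) (alpha : 'F_p)
    (C : {vspace 'rV['F_p]_n}) (g : {mpoly K[n * p.-1]}) : Prop :=
  code_binomials alpha C g \/ Iq_gens alpha g.

Lemma code_ideal_binomial (K : fieldType) (n p : nat) (alpha : 'F_p)
    (C : {vspace 'rV['F_p]_n}) (m1 m2 : 'X_{1..n * p.-1}) :
    prime p -> p.-1.-primitive_root alpha ->
    wt alpha m1 - wt alpha m2 \in C ->
  ideal_gen (code_ideal_gens (K := K) alpha C) ('X_[m1] - 'X_[m2]).
Proof.
move=> p_pr prim m12.
have cross m : ideal_gen (code_ideal_gens (K := K) alpha C)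
    ('X_[m] - 'X_[crossing alpha (wt alpha m)]).
  move: (mpolyX_crossing K m p_pr prim); apply: ideal_gen_sub => g Ig.
  by apply: ideal_gen_mem; right.
set X1 := 'X_[m1]; set X2 := 'X_[m2].
set Y1 : {mpoly K[_]} := 'X_[crossing alpha (wt alpha m1)].
set Y2 : {mpoly K[_]} := 'X_[crossing alpha (wt alpha m2)].
have -> : X1 - X2 = (X1 - Y1) + ((Y1 - Y2) - (X2 - Y2)).
  by rewrite opprB !addrA !subrK.
apply: ideal_genD; first exact: cross.
apply: ideal_genB; last exact: cross.
by apply: ideal_gen_mem; left; exists (wt alpha m1), (wt alpha m2).
Qed.

(** * Systematic coset representatives *)

(** Reduction of v by the rows of A, whose first k columns are the identity: the
    result is the element of v + C that vanishes on the first k coordinates. *)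
Definition coset_rep (F : fieldType) (n k : nat) (le_kn : (k <= n)%N)
    (A : 'M[F]_(k, n)) (v : 'rV[F]_n) : 'rV[F]_n :=
  v - \sum_(i < k) v 0 (widen_ord le_kn i) *: row i A.

Lemma standard_formE (F : fieldType) (n k : nat) (le_kn : (k <= n)%N)
    (A : 'M[F]_(k, n)) (i i' : 'I_k) :
  standard_form le_kn A -> A i (widen_ord le_kn i') = (i == i')%:R.
Proof.
case=> M ->; rewrite castmxE /= cast_ord_id.
have -> : cast_ord (esym (subnKC le_kn)) (widen_ord le_kn i') = lshift (n - k) i'.
  exact: val_inj.
by rewrite row_mxEl mxE.
Qed.

Lemma coset_rep_id (F : fieldType) (n k : nat) (le_kn : (k <= n)%N)
    (A : 'M[F]_(k, n)) (v : 'rV[F]_n) :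
    (forall j : 'I_n, (j < k)%N -> v 0 j = 0) ->
  coset_rep le_kn A v = v.
Proof.
move=> v0; rewrite /coset_rep big1 ?subr0 // => i _.
by rewrite v0 ?scale0r //=.
Qed.

Lemma coset_rep_pivot (F : fieldType) (n k : nat) (le_kn : (k <= n)%N)
    (A : 'M[F]_(k, n)) (v : 'rV[F]_n) (j : 'I_n) :
  standard_form le_kn A -> (j < k)%N -> coset_rep le_kn A v 0 j = 0.
Proof.
move=> A_std jk; rewrite !mxE summxE.
have -> : j = widen_ord le_kn (Ordinal jk) by apply: val_inj.
rewrite (bigD1 (Ordinal jk)) //= big1 => [|i neq]; rewrite !mxE standard_formE //.
  by rewrite eqxx mulr1 addr0 subrr.
by rewrite (negPf neq) mulr0.
Qed.

Lemma coset_repK (F : fieldType) (n k : nat) (le_kn : (k <= n)%N)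
    (A : 'M[F]_(k, n)) (v : 'rV[F]_n) :
    standard_form le_kn A ->
  coset_rep le_kn A (coset_rep le_kn A v) = coset_rep le_kn A v.
Proof. by move=> A_std; apply: coset_rep_id => j; apply: coset_rep_pivot. Qed.

Lemma coset_repD (F : fieldType) (n k : nat) (le_kn : (k <= n)%N)
    (A : 'M[F]_(k, n)) (v w : 'rV[F]_n) :
  coset_rep le_kn A (v + w) = coset_rep le_kn A v + coset_rep le_kn A w.
Proof.
rewrite /coset_rep addrACA -opprD -big_split; congr (_ - _).
by apply: eq_bigr => i _ /=; rewrite mxE scalerDl.
Qed.

Lemma coset_repZ (F : fieldType) (n k : nat) (le_kn : (k <= n)%N)
    (A : 'M[F]_(k, n)) (a : F) (v : 'rV[F]_n) :
  coset_rep le_kn A (a *: v) = a *: coset_rep le_kn A v.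
Proof.
rewrite /coset_rep scalerBr scaler_sumr; congr (_ - _).
by apply: eq_bigr => i _; rewrite mxE scalerA.
Qed.

Lemma coset_rep_row (F : fieldType) (n k : nat) (le_kn : (k <= n)%N)
    (A : 'M[F]_(k, n)) (i : 'I_k) :
  standard_form le_kn A -> coset_rep le_kn A (row i A) = 0.
Proof.
move=> A_std; rewrite /coset_rep (bigD1 i) //= mxE standard_formE // eqxx.
rewrite scale1r opprD addrA subrr add0r big1 ?oppr0 // => i' neq.
by rewrite mxE standard_formE // eq_sym (negPf neq) scale0r.
Qed.

(** Up to the scalar alpha^j, these are the exponents m_i^(j) of the explicit
    basis. *)
Lemma coset_rep_delta (F : fieldType) (n k : nat) (le_kn : (k <= n)%N)
    (A : 'M[F]_(k, n)) (i : 'I_k) :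
  coset_rep le_kn A (delta_mx 0 (widen_ord le_kn i))
  = delta_mx 0 (widen_ord le_kn i) - row i A.
Proof.
rewrite /coset_rep (bigD1 i) //= big1 => [|i' neq].
  by rewrite mxE !eqxx scale1r addr0.
by rewrite mxE eqxx -val_eqE /= val_eqE (negPf neq) scale0r.
Qed.

Lemma coset_rep_mem (F : fieldType) (n k : nat) (le_kn : (k <= n)%N)
    (A : 'M[F]_(k, n)) (C : {vspace 'rV[F]_n}) (v : 'rV[F]_n) :
  generator_matrix C A -> v - coset_rep le_kn A v \in C.
Proof.
move=> A_gen; rewrite opprB addrC subrK; apply: memv_suml => i _.
by apply/memvZ/(basis_mem A_gen)/map_f; rewrite mem_enum.
Qed.

Lemma coset_rep_code (F : fieldType) (n k : nat) (le_kn : (k <= n)%N)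
    (A : 'M[F]_(k, n)) (C : {vspace 'rV[F]_n}) (v : 'rV[F]_n) :
    generator_matrix C A -> standard_form le_kn A -> v \in C ->
  coset_rep le_kn A v = 0.
Proof.
move=> A_gen A_std; rewrite -(span_basis A_gen).
move=> /(coord_span (X := in_tuple _))->.
elim/big_ind: _ => [|x y x0 y0|i _].
- by rewrite -[0](scale0r 0) coset_repZ !scale0r.
- by rewrite coset_repD x0 y0 addr0.
rewrite coset_repZ.
have /mapP[i' _ ->] := mem_nth 0 (ltn_ord i : (i < size (in_tuple _))%N).
by rewrite coset_rep_row ?scaler0.
Qed.

(** * Normal forms of monomials *)

Definition last_mnm (n p : nat) (p_pr : prime p) (c : 'rV['F_p]_n) :
    'X_{1..n * p.-1} :=
  (\sum_(j < n) U_(var_idx j (last_col p_pr)) *+ (c 0%R j : nat))%MM.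

Lemma last_monomialE (K : fieldType) (n p : nat) (p_pr : prime p)
    (c : 'rV['F_p]_n) :
  last_monomial K p_pr c = 'X_[last_mnm p_pr c].
Proof.
rewrite /last_mnm (big_morph _ (@mpolyXD _ K) (@mpolyX0 _ K)).
by apply: eq_bigr => j _; rewrite -mpolyXn.
Qed.

Lemma last_mnmE (n p : nat) (p_pr : prime p) (c : 'rV['F_p]_n) j u :
  last_mnm p_pr c (var_idx j u) = if u == last_col p_pr then (c 0 j : nat) else 0%N.
Proof.
rewrite mnm_sumE (bigD1 j) //= big1 => [|i ij]; last first.
  by rewrite mulmnE mnm1E var_idx_eq (negPf ij) mul0n.
rewrite mulmnE mnm1E var_idx_eq eqxx /= addn0 eq_sym.
by case: eqP => _; rewrite ?mul0n ?mul1n.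
Qed.

Lemma last_colS (p : nat) (p_pr : prime p) : (last_col p_pr).+1 = p.-1.
Proof. by rewrite /=; case: p p_pr => [|[]]. Qed.

Lemma expr_last_col (p : nat) (p_pr : prime p) (alpha : 'F_p) :
  p.-1.-primitive_root alpha -> alpha ^+ (last_col p_pr).+1 = 1.
Proof. by move=> prim; rewrite last_colS prim_expr_order. Qed.

Lemma wt_last_row (n p : nat) (p_pr : prime p) (alpha : 'F_p)
    (m : 'X_{1..n * p.-1}) (j : 'I_n) :
    p.-1.-primitive_root alpha ->
    (forall u, u != last_col p_pr -> m (var_idx j u) = 0%N) ->
  wt alpha m 0 j = (m (var_idx j (last_col p_pr)))%:R.
Proof.
move=> prim m0; rewrite mxE (bigD1 (last_col p_pr)) //= big1 => [|u /m0->//].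
by rewrite expr_last_col // addr0.
Qed.

Lemma wt_last_mnm (n p : nat) (p_pr : prime p) (alpha : 'F_p)
    (c : 'rV['F_p]_n) :
  p.-1.-primitive_root alpha -> wt alpha (last_mnm p_pr c) = c.
Proof.
move=> prim; apply/rowP => j; rewrite (wt_last_row (p_pr := p_pr)) => // [|u neq].
  by rewrite last_mnmE eqxx natr_Zp.
by rewrite last_mnmE (negPf neq).
Qed.

Definition normal_mnm (n k p : nat) (p_pr : prime p) (le_kn : (k <= n)%N)
    (alpha : 'F_p) (A : 'M['F_p]_(k, n)) (m : 'X_{1..n * p.-1}) :
    'X_{1..n * p.-1} :=
  last_mnm p_pr (coset_rep le_kn A (wt alpha m)).

(** The variables x_{j,p-1} with j > k, that is k <= j with rows numbered from 0:
    the only ones that occur in normal forms. *)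
Definition free_var (n k p : nat) (p_pr : prime p) (j : 'I_n) (u : 'I_p.-1) :
    bool :=
  (k <= j)%N && (u == last_col p_pr).

Inductive corner (n k p : nat) (p_pr : prime p) : 'X_{1..n * p.-1} -> Prop :=
| CornerVar j u of ~~ free_var k p_pr j u : corner k p_pr U_(var_idx j u)
| CornerPow (j : 'I_n) of (k <= j)%N :
    corner k p_pr (U_(var_idx j (last_col p_pr)) *+ p).

Lemma normal_mnmE (n k p : nat) (p_pr : prime p) (le_kn : (k <= n)%N)
    (alpha : 'F_p) (A : 'M['F_p]_(k, n)) (m : 'X_{1..n * p.-1}) j u :
    standard_form le_kn A ->
  normal_mnm p_pr le_kn alpha A m (var_idx j u)
  = if free_var k p_pr j u then (coset_rep le_kn A (wt alpha m) 0 j : nat) else 0%N.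
Proof.
move=> A_std; rewrite last_mnmE /free_var; case: leqP => // jk.
by rewrite coset_rep_pivot ?if_same.
Qed.

Lemma wt_normal_mnm (n k p : nat) (p_pr : prime p) (le_kn : (k <= n)%N)
    (alpha : 'F_p) (A : 'M['F_p]_(k, n)) (m : 'X_{1..n * p.-1}) :
    p.-1.-primitive_root alpha ->
  wt alpha (normal_mnm p_pr le_kn alpha A m) = coset_rep le_kn A (wt alpha m).
Proof. exact: wt_last_mnm. Qed.

Lemma eq_normal_mnm (n k p : nat) (p_pr : prime p) (le_kn : (k <= n)%N)
    (alpha : 'F_p) (A : 'M['F_p]_(k, n)) (m1 m2 : 'X_{1..n * p.-1}) :
    coset_rep le_kn A (wt alpha m1) = coset_rep le_kn A (wt alpha m2) ->
  normal_mnm p_pr le_kn alpha A m1 = normal_mnm p_pr le_kn alpha A m2.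
Proof. by rewrite /normal_mnm => ->. Qed.

Lemma normal_mnmK (n k p : nat) (p_pr : prime p) (le_kn : (k <= n)%N)
    (alpha : 'F_p) (A : 'M['F_p]_(k, n)) (m : 'X_{1..n * p.-1}) :
    p.-1.-primitive_root alpha -> standard_form le_kn A ->
  normal_mnm p_pr le_kn alpha A (normal_mnm p_pr le_kn alpha A m)
  = normal_mnm p_pr le_kn alpha A m.
Proof.
move=> prim A_std; apply: eq_normal_mnm; rewrite (wt_normal_mnm _ _ _ _ prim).
exact: coset_repK.
Qed.

(** If the rows before k and the columns before the last of row j are empty,
    then coordinate j of the weight is not altered by the reduction and is just
    an exponent modulo p. *)
Lemma val_coset_rep_wt (n k p : nat) (p_pr : prime p) (le_kn : (k <= n)%N)
    (alpha : 'F_p) (A : 'M['F_p]_(k, n)) (m : 'X_{1..n * p.-1}) (j : 'I_n) :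
    p.-1.-primitive_root alpha ->
    (forall (i : 'I_n) u, (i < k)%N -> m (var_idx i u) = 0%N) ->
    (forall u, u != last_col p_pr -> m (var_idx j u) = 0%N) ->
  coset_rep le_kn A (wt alpha m) 0 j
  = (m (var_idx j (last_col p_pr)) %% p)%N :> nat.
Proof.
move=> prim mk mj; rewrite coset_rep_id => [|i ik].
  by rewrite (wt_last_row (p_pr := p_pr)) // val_Fp_nat.
by rewrite (wt_last_row (p_pr := p_pr)) ?mk // => u _; rewrite mk.
Qed.

(** Suppose that m is smaller, and let x_{ju} be the first variable where it
    differs from its normal form N.  The exponent of N there is positive, so
    this is a free variable; as N has no earlier variable in row j or in the
    first k rows, neither has m, and both exponents are determined by the
    coordinate j of the weight: that of N is the remainder modulo p of that of
    m, hence not larger. *)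
Lemma normal_mnm_le (n k p : nat) (p_pr : prime p) (le_kn : (k <= n)%N)
    (alpha : 'F_p) (A : 'M['F_p]_(k, n)) (m : 'X_{1..n * p.-1}) :
    p.-1.-primitive_root alpha -> standard_form le_kn A ->
  lexmn (normal_mnm p_pr le_kn alpha A m) m.
Proof.
move=> prim A_std; apply: contraT => /lexmnPn[t].
have [j [u ->]] := var_idx_surj t; rewrite normal_mnmE //.
have [/andP[kj /eqP->] eq_before|//] := ifPn.
rewrite val_coset_rep_wt //; first by rewrite ltnNge leq_mod.
  move=> i v ik; rewrite -eq_before ?normal_mnmE // /free_var.
    by rewrite leqNgt ik.
  by rewrite var_idx_lt // (leq_trans ik kj).
move=> v neq; rewrite -eq_before ?normal_mnmE // /free_var ?(negPf neq) ?andbF //.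
rewrite var_idx_lt // ltnn eqxx ltn_neqAle (neq : (v : nat) != _).
by rewrite -ltnS last_colS ltn_ord.
Qed.

(** A monomial with no corner below it has only free variables, with exponents
    below p, and these exponents can be read off its weight. *)
Lemma normal_mnm_corner (n k p : nat) (p_pr : prime p) (le_kn : (k <= n)%N)
    (alpha : 'F_p) (A : 'M['F_p]_(k, n)) (m : 'X_{1..n * p.-1}) :
    p.-1.-primitive_root alpha -> standard_form le_kn A ->
  normal_mnm p_pr le_kn alpha A m != m
  <-> exists2 b, corner k p_pr b & (b <= m)%MM.
Proof.
move=> prim A_std; split=> [neq|[b Cb bm]]; last first.
  apply/eqP => E; case: Cb bm => [j u nfree|j kj] /mnm_lepP/(_ (var_idx j _)).
    by move=> /(_ u); rewrite mnm1E eqxx -E normal_mnmE // (negPf nfree).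
  move=> /(_ (last_col p_pr)).
  rewrite mulmnE mnm1E eqxx mul1n -E normal_mnmE // /free_var kj eqxx /=.
  by rewrite leqNgt -[X in (_ < X)%N](Fp_cast p_pr) ltn_ord.
case: (pickP [pred ju : 'I_n * 'I_p.-1 |
    ~~ free_var k p_pr ju.1 ju.2 && (m (var_idx ju.1 ju.2) != 0%N)]) => [[j u]|none1].
  move=> /andP[/= nfree mju]; exists U_(var_idx j u)%MM; first exact: CornerVar.
  by rewrite lep1mP.
case: (pickP [pred j : 'I_n |
    (k <= j)%N && (p <= m (var_idx j (last_col p_pr)))%N]) => [j|none2].
  move=> /andP[kj pm]; exists (U_(var_idx j (last_col p_pr)) *+ p)%MM.
    exact: CornerPow.
  apply/mnm_lepP => t; rewrite mulmnE mnm1E.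
  by case: eqP => [<-|_]; rewrite ?mul1n ?mul0n.
have m0 j u : ~~ free_var k p_pr j u -> m (var_idx j u) = 0%N.
  by move=> nfree; have /= := none1 (j, u); rewrite nfree => /negbFE/eqP.
case/eqP: neq; apply/mnmP => t; have [j [u ->]] := var_idx_surj t.
rewrite normal_mnmE //; case: ifPn => [/andP[kj /eqP->]|/m0//].
rewrite val_coset_rep_wt // => [|i v ik|v neq].
- by rewrite modn_small // ltnNge; have /= := none2 j; rewrite kj /= => ->.
- by rewrite m0 // /free_var leqNgt ik.
by rewrite m0 // /free_var (negPf neq) andbF.
Qed.

Lemma corner_antichain (n k p : nat) (p_pr : prime p) (a b : 'X_{1..n * p.-1}) :
  corner k p_pr a -> corner k p_pr b -> (a <= b)%MM -> a = b.
Proof.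
have p0 := prime_gt0 p_pr.
case=> [j u nf|j kj] [j' u' nf'|j' kj'] /mnm_lepP.
- move=> /(_ (var_idx j u)); rewrite !mnm1E eqxx.
  by case: eqP => [->|].
- move=> /(_ (var_idx j u)); rewrite mulmnE !mnm1E eqxx var_idx_eq.
  case: eqP nf => [<-|//]; case: eqP => [<-|//].
  by rewrite /free_var kj' eqxx.
- move=> /(_ (var_idx j (last_col p_pr))); rewrite mulmnE !mnm1E eqxx mul1n.
  case: eqP => [_|_]; last by rewrite leqNgt p0.
  by rewrite leqNgt prime_gt1.
move=> /(_ (var_idx j (last_col p_pr))); rewrite !mulmnE !mnm1E eqxx mul1n.
by case: eqP => [->//|_]; rewrite mul0n leqNgt p0.
Qed.

(** * The explicit basis *)

Lemma explicit_basisE (K : fieldType) (n k p : nat) (p_pr : prime p)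
    (le_kn : (k <= n)%N) (alpha : 'F_p) (A : 'M['F_p]_(k, n))
    (g : {mpoly K[n * p.-1]}) :
    p.-1.-primitive_root alpha ->
  g \in explicit_basis K p_pr le_kn alpha A
  <-> exists2 b, corner k p_pr b
        & g = 'X_[b] - 'X_[normal_mnm p_pr le_kn alpha A b].
Proof.
move=> prim.
(* The families are the binomials of, in this order, the corners x_{ij} with
   i among the first k rows, the other corners x_{ij}, and the powers. *)
have E1 i j : var K (widen_ord le_kn i) j
      - last_monomial K p_pr (mvec le_kn alpha A i j)
    = 'X_[U_(var_idx (widen_ord le_kn i) j)]
      - 'X_[normal_mnm p_pr le_kn alpha A U_(var_idx (widen_ord le_kn i) j)].
  by rewrite last_monomialE /normal_mnm wtU coset_repZ coset_rep_delta.
have nfU (i : 'I_n) (j : 'I_p.-1) : (k <= i)%N ->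
    normal_mnm p_pr le_kn alpha A U_(var_idx i j)
    = (U_(var_idx i (last_col p_pr)) *+ (alpha ^+ j.+1 : 'F_p))%MM.
  move=> ki; rewrite /normal_mnm wtU coset_rep_id => [|i' i'k].
    rewrite /last_mnm (bigD1 i) //= big1 => [|i' neq].
      by rewrite addm0 !mxE !eqxx mulr1.
    by rewrite !mxE eqxx (negPf neq) mulr0 mulm0n.
  by rewrite !mxE eqxx -val_eqE /= ltn_eqF ?mulr0 // (leq_trans i'k ki).
have E2 (i : 'I_n) (j : 'I_p.-1) : (k <= i)%N ->
    var K i j - var K i (last_col p_pr) ^+ (alpha ^+ j.+1 : 'F_p)
    = 'X_[U_(var_idx i j)]
      - 'X_[normal_mnm p_pr le_kn alpha A U_(var_idx i j)].
  by move=> ki; rewrite nfU // mpolyXn.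
have E3 (i : 'I_n) : (k <= i)%N -> var K i (last_col p_pr) ^+ p - 1
    = 'X_[U_(var_idx i (last_col p_pr)) *+ p]
      - 'X_[normal_mnm p_pr le_kn alpha A (U_(var_idx i (last_col p_pr)) *+ p)].
  move=> ki; rewrite mpolyXn /normal_mnm wtMn -scaler_nat pchar_Fp_0 // scale0r.
  rewrite coset_rep_id => [|i' _]; last by rewrite mxE.
  by rewrite /last_mnm big1 ?mpolyX0 // => i' _; rewrite mxE mulm0n.
rewrite !in_fsetU; split.
  case/orP=> [/orP[]|].
  - case/imfset2P=> i _ [j _ ->]; rewrite E1.
    exists U_(var_idx (widen_ord le_kn i) j)%MM => //; apply: CornerVar.
    by rewrite /free_var leqNgt /= ltn_ord.
  - case/imfset2P=> i ki [j jp ->]; rewrite E2 //.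
    exists U_(var_idx i j)%MM => //; apply: CornerVar.
    rewrite /free_var (ki : (k <= i)%N) /=; apply/eqP => E.
    by move: jp; rewrite E inE /= ltnn.
  case/imfsetP=> i ki ->; rewrite E3 //.
  by exists (U_(var_idx i (last_col p_pr)) *+ p)%MM => //; apply: CornerPow.
case=> b [j u nfree ->|j kj ->]; last first.
  by apply/orP; right; apply/imfsetP; exists j; rewrite ?E3.
apply/orP; left; case: (ltnP j k) => [jk|kj].
  apply/orP; left; apply/imfset2P; exists (Ordinal jk) => //.
  exists u; first by [].
  have Ej : widen_ord le_kn (Ordinal jk) = j by apply: val_inj.
  by rewrite E1 Ej.
apply/orP; right; apply/imfset2P; exists j => //; exists u; last by rewrite E2.
move: nfree; rewrite /free_var kj /= -val_eqE /= => neq.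
rewrite inE ltn_neqAle neq -ltnS.
by rewrite (last_colS p_pr : p.-2.+1 = p.-1) ltn_ord.
Qed.

Theorem theorem4p5 (K : fieldType) (p : nat) (p_pr : prime p)
    (alpha : 'F_p) (alpha_prim : (p.-1).-primitive_root alpha)
    (n k : nat) (le_kn : (k <= n)%N)
    (C : {vspace 'rV['F_p]_n}) (dimC : \dim C = k)
    (A : 'M['F_p]_(k, n)) (A_gen : generator_matrix C A)
    (A_std : standard_form le_kn A) :
  unique
    (reduced_groebner_basis (@lexmn (n * p.-1)) (code_ideal (K := K) alpha C))
    (explicit_basis K p_pr le_kn alpha A).
Proof.
have ext := lexmn_divext (n * p.-1).
have idealE (f : {mpoly K[n * p.-1]}) :
    code_ideal alpha C f <-> ideal_gen (code_ideal_gens alpha C) f.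
  exact: ideal_add_gen.
pose nf := normal_mnm p_pr le_kn alpha A.
have nf_eq m1 m2 : wt alpha m1 - wt alpha m2 \in C -> nf m1 = nf m2.
  move=> /(coset_rep_code A_gen A_std) E; apply: eq_normal_mnm.
  by rewrite -[wt alpha m1](subrK (wt alpha m2)) coset_repD E add0r.
have nf_wt m1 m2 : wt alpha m1 = wt alpha m2 -> nf m1 = nf m2.
  by move=> E; apply: nf_eq; rewrite E subrr mem0v.
have wt_nf m : wt alpha (nf m) = coset_rep le_kn A (wt alpha m).
  exact: wt_normal_mnm.
have nfD m a b : nf a = nf b -> nf (m + a)%MM = nf (m + b)%MM.
  move=> /(congr1 (wt alpha)); rewrite [LHS]wt_nf [RHS]wt_nf => E.
  by apply: eq_normal_mnm; rewrite !wtD !coset_repD E.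
have nf_le m : lexmn (nf m) m by exact: normal_mnm_le.
have nfK m : nf (nf m) = nf m by exact: normal_mnmK.
have I_nf m : code_ideal (K := K) alpha C ('X_[m] - 'X_[nf m]).
  apply/idealE/(code_ideal_binomial _ p_pr alpha_prim).
  by rewrite wt_nf; apply: coset_rep_mem.
have sum_I (f : {mpoly K[n * p.-1]}) c :
    code_ideal alpha C f -> class_sum nf c f = 0.
  move=> /idealE; apply: class_sum_ideal nfD _ f c => g [[a [b [ab ->]]]|].
    exists (crossing alpha a), (crossing alpha b); split; last by [].
    by apply: nf_eq; rewrite [wt _ _]wt_crossing // [wt _ _]wt_crossing.
  case=> [[j [u [v [w [E ->]]]]]|[j [u [v [E ->]]]]].
    exists (U_(var_idx j u) + U_(var_idx j v))%MM, U_(var_idx j w)%MM.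
    rewrite mpolyXD; split; last by [].
    by apply: nf_wt; rewrite wtD !wtU -scalerDl E.
  exists (U_(var_idx j u) + U_(var_idx j v))%MM, 0%MM.
  rewrite mpolyXD mpolyX0; split; last by [].
  by apply: nf_wt; rewrite wtD !wtU -scalerDl E scale0r wt0.
have cornerP m := normal_mnm_corner p_pr m alpha_prim A_std.
have basisP (g : {mpoly K[n * p.-1]}) :=
  explicit_basisE p_pr le_kn A g alpha_prim.
have red := reduced_groebner_normal_form ext nf_le nfK I_nf sum_I cornerP
  (@corner_antichain n k p p_pr) basisP.
split=> // G redG; apply: reduced_groebner_basis_uniq red redG => // f g.
by move=> /idealE If /idealE Ig; apply/idealE/ideal_genB.
Qed.
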